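(* Let $q$ be a prime power, $P \in \mathbb{F}_q[x]$ an irreducible polynomial, $k \geq 1$, and $D \subset \mathrm{Div}(P^k)$ with $P^k \notin D$; put $s = |D|$. Then the independence number of $G_{P^k}(D)$ is $|P|^{k-|D|} = |P|^{k-s}$.
   Context: $|P| = q^{\deg P}$, while $|D|$ is the cardinality of the finite set $D$. For a nonconstant $f \in \mathbb{F}_q[x]$, $\mathrm{Div}(f)$ is the set of divisors of $f$ up to multiplication by nonzero constants; for $D \subset \mathrm{Div}(f)$ with $f \notin D$, the gcd-graph $G_f(D)$ is the simple undirected graph with vertex set $\mathbb{F}_q[x]/f$ in which $a,b$ are adjacent iff $\gcd(a-b,f) \in D$ (gcd taken up to nonzero constants). The independence number of a graph is the maximum size of a set of pairwise non-adjacent vertices. *)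

(* Defs.v *)
From mathcomp Require Import all_boot all_order all_algebra all_field.
From mathcomp Require Import finmap.

Set Implicit Arguments.
Unset Strict Implicit.
Unset Printing Implicit Defensive.

Import GRing.Theory.
Local Open Scope ring_scope.

(* A class of nonzero polynomials up to nonzero constants is represented by
   its unique monic element. *)
Definition monicp (F : fieldType) (p : {poly F}) : {poly F} :=
  (lead_coef p)^-1 *: p.

Definition Div (F : fieldType) (f : {poly F}) : pred {poly F} :=
  [pred d | (d \is monic) && (d %| f)].

(* Intended for nonconstant f only.  [{poly %/ h}] is the quotient by h when h
   is monic and nonconstant, and the quotient by 'X otherwise; hence
   [monicp f], which generates the same ideal as f.  An element of
   [{poly %/ h}] coerces to its representative of degree less than deg h. *)
Definition gcd_graph (F : finFieldType) (f : {poly F}) (D : {fset {poly F}}) :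
    rel {poly %/ monicp f} :=
  fun a b => monicp (gcdp (a - b : {poly %/ monicp f}) f) \in D.
Arguments gcd_graph {F} f D.

Lemma eq_monicp (F : fieldType) (p r : {poly F}) :
  p %= r -> monicp p = monicp r.
Proof.
case/eqpf_eq=> c c0 ->.
by rewrite /monicp lead_coefZ invfM scalerA mulrAC mulVf // mul1r.
Qed.

Lemma gcd_graph_sym (F : finFieldType) (f : {poly F}) (D : {fset {poly F}}) :
  symmetric (gcd_graph f D).
Proof.
move=> a b; rewrite /gcd_graph -(opprB b a) [polyn (- _)]raddfN /=.
rewrite (@eq_monicp _ _ (gcdp (b - a : {poly %/ monicp f}) f)) //.
by apply: eqp_gcdl; rewrite -scaleN1r eqp_scale // oppr_eq0 oner_eq0.
Qed.

Lemma gcd_graph_irrefl (F : finFieldType) (f : {poly F}) (D : {fset {poly F}}) :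
  monicp f \notin D -> irreflexive (gcd_graph f D).
Proof.
by move=> fD a; rewrite /gcd_graph subrr raddf0 gcd0p (negbTE fD).
Qed.

Definition independent (T : finType) (e : rel T) (A : {set T}) : bool :=
  [forall x in A, forall y in A, (x != y) ==> ~~ e x y].

Definition independence_number (T : finType) (e : rel T) : nat :=
  \max_(A : {set T} | independent e A) #|A|.

Definition poly_norm (F : finFieldType) (p : {poly F}) : nat :=
  (#|F| ^ (size p).-1)%N.

(* Main.v *)
(** Write [P^i], [i] in [I], for the elements of [D].  Call [C_J] the set of
    residues modulo [P^k] whose base-[P] digits vanish outside [J]; for two
    distinct elements of [C_J], the gcd of their difference with [P^k] is [P^i]
    where [i], the first position at which their digits differ, lies in [J].
    Hence [C_(~I)] is an independent set with [|P|^(k-s)] elements.  Conversely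
    [C_I] is a clique with [|P|^s] elements, and since adjacency is translation
    invariant, addition [A * C_I -> F[x]/P^k] is injective for every independent
    set [A], so that [#|A| * |P|^s <= |P|^k]. *)

Require Import Defs.
From mathcomp Require Import all_boot all_order all_algebra all_field.
From mathcomp Require Import finmap.

Set Implicit Arguments.
Unset Strict Implicit.
Unset Printing Implicit Defensive.

Import GRing.Theory.
Local Open Scope ring_scope.

Lemma eqp_monicp (F : fieldType) (p : {poly F}) : p != 0 -> monicp p %= p.
Proof. by move=> p0; rewrite /monicp eqp_scale // invr_eq0 lead_coef_eq0. Qed.

Lemma monicp_monic (F : fieldType) (p : {poly F}) :
  p != 0 -> monicp p \is monic.
Proof.
by move=> p0; rewrite monicE /monicp lead_coefZ mulVf // lead_coef_eq0.
Qed.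

Lemma monicp_id (F : fieldType) (p : {poly F}) : p \is monic -> monicp p = p.
Proof. by move/monicP; rewrite /monicp => ->; rewrite invr1 scale1r. Qed.

Lemma monicpX_inj (F : fieldType) (P : {poly F}) :
  (1 < size P)%N -> injective (fun i => monicp (P ^+ i)).
Proof.
move=> P1 i j /= eq_ij.
have P0 m : P ^+ m != 0 by rewrite expf_neq0 // -size_poly_gt0 ltnW.
have: P ^+ i %= P ^+ j.
  by rewrite -(eqp_ltrans (eqp_monicp (P0 i))) eq_ij eqp_monicp.
by rewrite /eqp !dvdp_Pexp2l // -eqn_leq => /eqP.
Qed.

(** Induction on [k]: either [P] divides [d] and one factor is cancelled, or [d] is coprime to [P]
    and Gauss removes a factor from [P ^+ k]. *)
Lemma irreducible_dvdp_exp (F : fieldType) (P d : {poly F}) (k : nat) :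
  irreducible_poly P -> d %| P ^+ k -> exists2 i, (i <= k)%N & d %= P ^+ i.
Proof.
move=> hP; elim: k d => [|k IHk] d.
  by rewrite expr0 dvdp1 => d1; exists 0; rewrite // expr0 -size_poly_eq1.
have [/dvdpP[e ->]|nPd] := boolP (P %| d).
  rewrite exprSr dvdp_mul2r ?irredp_neq0 // => /IHk[i le_ik e_i].
  by exists i.+1; rewrite // exprSr eqp_mulr.
rewrite exprS Gauss_dvdpr; last first.
  by rewrite coprimep_sym irreducible_poly_coprime.
by case/IHk=> i le_ik d_i; exists i; rewrite // ltnW.
Qed.

Section Digits.

Variables (F : finFieldType) (P : {poly F}) (k : nat).
Hypothesis hP : irreducible_poly P.
Hypothesis hk : (0 < k)%N.

Local Notation digits := {ffun 'I_k -> {poly_(size P).-1 F}}.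
Local Notation quot := {poly %/ monicp (P ^+ k)}.

(** Digits have size at most [(size P).-1], that is, degree less than [deg P]. Such polynomials are
    closed under subtraction, so base-[P] subtraction never borrows. *)
Definition of_digits (x : digits) : {poly F} :=
  \sum_(i < k) (x i : {poly F}) * P ^+ i.

Lemma of_digitsB (x y : digits) : of_digits (x - y) = of_digits x - of_digits y.
Proof.
rewrite /of_digits -sumrB; apply: eq_bigr => i _.
by rewrite !ffunE raddfB mulrBl.
Qed.

(** The witness [i] is the lowest position with a nonzero digit: once [P ^+ i] is factored out, the
    cofactor is congruent to [x i] modulo [P], hence coprime to [P]. *)
Lemma gcdp_of_digits (x : digits) : x != 0 ->
  exists2 i : 'I_k, x i != 0 & gcdp (of_digits x) (P ^+ k) %= P ^+ i.
Proof.
move=> x0; have [i0 xi0]: exists i, x i != 0.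
  apply/existsP; apply: contraNT x0 => /existsPn xP.
  by apply/eqP/ffunP => i; rewrite ffunE; apply/eqP/negPn/xP.
case: (arg_minnP (P := fun i => x i != 0) val xi0) => i xi min_i.
exists i => //.
(* For [j < i] the exponent truncates to 0, harmlessly: minimality of [i] makes [x j] zero. *)
pose r := \sum_(j < k | j != i) (x j : {poly F}) * P ^+ (j - i.+1).
have ->: of_digits x = P ^+ i * ((x i : {poly F}) + P * r).
  rewrite mulrDr [P ^+ i * _]mulrC /of_digits (bigD1 i) //=; congr (_ + _).
  rewrite mulrA -exprSr mulr_sumr; apply: eq_bigr => j ne_ji.
  have [->|xj] := eqVneq (x j) 0; first by rewrite !(mul0r, mulr0).
  rewrite mulrCA -exprD subnKC // ltn_neqAle min_i // andbT.
  by rewrite eq_sym.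
have ->: P ^+ k = P ^+ i * P ^+ (k - i) by rewrite -exprD subnKC // ltnW.
apply: eqp_trans (gcdp_mul2l _ _ _) _.
rewrite -[X in _ %= X]mulr1 eqp_mull // -size_poly_eq1.
rewrite -/(coprimep _ _) coprimep_sym coprimep_expl //.
rewrite irreducible_poly_coprime // dvdp_addl ?dvdp_mulr //.
(* [P] cannot divide the nonzero digit [x i], whose size is smaller. *)
apply/negP => /dvdp_leq; rewrite -[_ == 0]/(x i == 0) => /(_ xi).
apply/negP; rewrite -ltnNge -[ltnRHS]prednK ?ltnS ?size_npoly //.
by rewrite ltnW // hP.1.
Qed.

Let Pn0 m : P ^+ m != 0. Proof. by rewrite expf_neq0 // irredp_neq0. Qed.

Lemma size_monicpX : (size (monicp (P ^+ k))).-1 = ((size P).-1 * k)%N.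
Proof. by rewrite (eqp_size (eqp_monicp (Pn0 k))) size_exp. Qed.

Lemma size_monicpX_gt1 : (1 < size (monicp (P ^+ k)))%N.
Proof.
by rewrite -subn_gt0 subn1 size_monicpX muln_gt0 hk -subn1 subn_gt0 hP.1.
Qed.

(** The default modulus ['X] is not taken, since [0 < k] makes the modulus nonconstant. *)
Lemma mk_monic_monicpX : mk_monic (monicp (P ^+ k)) = monicp (P ^+ k).
Proof. by rewrite /mk_monic size_monicpX_gt1 monicp_monic. Qed.

Lemma card_quot : #|quot| = (poly_norm P ^ k)%N.
Proof.
rewrite card_monic_qpoly ?size_monicpX_gt1 ?monicp_monic //.
by rewrite size_monicpX expnM.
Qed.

Lemma gcdp_in_qpoly p :
  gcdp (in_qpoly (monicp (P ^+ k)) p : quot) (P ^+ k) %= gcdp p (P ^+ k).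
Proof.
rewrite /= mk_monic_monicpX -Pdiv.IdomainMonic.modpE ?monicp_monic //.
have hE := eqp_monicp (Pn0 k).
rewrite -(eqp_rtrans (eqp_gcdr p hE)) -(eqp_ltrans (eqp_gcdr _ hE)).
exact: gcdp_modl.
Qed.

Definition quot_of_digits (x : digits) : quot := in_qpoly _ (of_digits x).

Lemma gcdp_quot_of_digits (x y : digits) : x != y ->
  exists2 i : 'I_k, x i != y i &
    gcdp (quot_of_digits x - quot_of_digits y : quot) (P ^+ k) %= P ^+ i.
Proof.
rewrite -subr_eq0 => /gcdp_of_digits[i xyi gcd_i]; exists i.
  by move: xyi; rewrite !ffunE subr_eq0.
rewrite -(eqp_rtrans gcd_i) of_digitsB /quot_of_digits -raddfB.
exact: gcdp_in_qpoly.
Qed.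

(** A collision would make the gcd of the difference with [P ^+ k] equal to [P ^+ k] itself, whereas
    distinct digits give some [P ^+ i] with [i < k]. *)
Lemma quot_of_digits_inj : injective quot_of_digits.
Proof.
move=> x y eq_xy; apply: contraTeq isT => /gcdp_quot_of_digits[i _].
rewrite eq_xy subrr raddf0 gcd0p /eqp !dvdp_Pexp2l ?hP.1 //.
by rewrite leqNgt ltn_ord.
Qed.

(** This is [C_J]: [pffun_on 0 J predT] consists of the digit sequences supported in [J]. *)
Definition digit_set (J : {set 'I_k}) : {set quot} :=
  [set quot_of_digits x | x in pffun_on 0 J predT].

Lemma card_digit_set J : #|digit_set J| = (poly_norm P ^ #|J|)%N.
Proof.
by rewrite card_imset ?card_pffun_on ?card_npoly //; apply: quot_of_digits_inj.
Qed.

Lemma gcdp_digit_set J u v : u \in digit_set J -> v \in digit_set J -> u != v ->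
  exists2 i : 'I_k, i \in J & gcdp (u - v : quot) (P ^+ k) %= P ^+ i.
Proof.
case/imsetP=> x /pffun_onP[xJ _] -> /imsetP[y /pffun_onP[yJ _] ->] ne_uv.
have /gcdp_quot_of_digits[i xyi gcd_i] : x != y.
  by apply: contraNneq ne_uv => ->.
exists i => //; apply: contraNT xyi => iJ.
have zJ (z : digits) : support z \subset J -> z i = 0.
  by move/subsetP=> sJ; apply/eqP; apply: contraNT iJ => zi; apply: sJ.
by rewrite !zJ.
Qed.

Variable D : {fset {poly F}}.

Definition exponents := [set i : 'I_k | monicp (P ^+ i) \in D].

Lemma gcd_graph_digit_set J u v :
    u \in digit_set J -> v \in digit_set J -> u != v ->
  exists2 i, i \in J & gcd_graph (P ^+ k) D u v = (i \in exponents).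
Proof.
move=> uJ vJ /(gcdp_digit_set uJ vJ)[i iJ gcd_i]; exists i => //.
by rewrite inE /gcd_graph (eq_monicp gcd_i).
Qed.

Lemma card_exponents :
    {subset D <= Div (P ^+ k)} -> monicp (P ^+ k) \notin D ->
  #|exponents| = #|` D|.
Proof.
move=> hD hPk; pose f (i : 'I_k) := monicp (P ^+ i).
have f_inj : injective f by move=> i j /(monicpX_inj hP.1)/val_inj.
rewrite cardE -(size_map f); apply/perm_size/uniq_perm.
- by rewrite map_inj_uniq ?enum_uniq.
- exact: fset_uniq.
move=> d; apply/mapP/idP => [[i] | dD]; first by rewrite mem_enum inE => iD ->.
have /andP[d_monic /(irreducible_dvdp_exp hP)[i le_ik d_i]] := hD d dD.
have dE : d = monicp (P ^+ i) by rewrite -(eq_monicp d_i) monicp_id.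
(* The exponent [k] is excluded because the monic associate of [P ^+ k] is not in [D]. *)
have lt_ik : (i < k)%N.
  by rewrite ltn_neqAle le_ik andbT; apply: contraNneq hPk => <-; rewrite -dE.
by exists (Ordinal lt_ik); rewrite // mem_enum inE -dE.
Qed.

Lemma independent_digit_set :
  independent (gcd_graph (P ^+ k) D) (digit_set (~: exponents)).
Proof.
apply/forall_inP => u uJ; apply/forall_inP => v vJ; apply/implyP => ne_uv.
have [i] := gcd_graph_digit_set uJ vJ ne_uv.
by rewrite inE => /negPf-> ->.
Qed.

Lemma leq_card_independent (A : {set quot}) :
    independent (gcd_graph (P ^+ k) D) A ->
  (#|A| * poly_norm P ^ #|exponents| <= poly_norm P ^ k)%N.
Proof.
move=> A_indep; rewrite -card_digit_set -cardsX -card_quot.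
have add_inj :
  {in setX A (digit_set exponents) &, injective (fun u => u.1 + u.2)}.
  move=> [a c] [b d] /setXP[/= aA cC] /setXP[/= bA dC] eq_add.
  have [eq_cd | ne_cd] := eqVneq c d.
    by move: eq_add; rewrite eq_cd => /addIr->.
  have eq_sub : a - b = d - c.
    by apply/eqP; rewrite subr_eq addrAC eq_sym subr_eq addrC -eq_add.
  have ne_ab : a != b by rewrite -subr_eq0 eq_sub subr_eq0 eq_sym.
  (* The clique edge between [d] and [c] depends only on [d - c], which is [a - b]; so [a] and [b]
     would be adjacent inside [A]. *)
  have [|i iI] := gcd_graph_digit_set dC cC; first by rewrite eq_sym.
  rewrite iI /gcd_graph -eq_sub => ab_adj.
  move/forall_inP: A_indep => /(_ a aA)/forall_inP/(_ b bA)/implyP/(_ ne_ab).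
  by rewrite /gcd_graph ab_adj.
by rewrite -(card_in_imset add_inj) max_card.
Qed.

End Digits.

Theorem corollary3p8 (F : finFieldType) (P : {poly F}) (k : nat)
    (D : {fset {poly F}}) (s : nat)
    (hP : irreducible_poly P)
    (hk : (1 <= k)%N)
    (hD : {subset D <= Div (P ^+ k)})
    (hPk : monicp (P ^+ k) \notin D)
    (hs : s = #|` D|) :
  independence_number (gcd_graph (P ^+ k) D) = (poly_norm P ^ (k - s))%N.
Proof.
have card_I : #|exponents P k D| = s by rewrite hs card_exponents.
(* This makes the truncated [k - s] a true difference. *)
have le_sk : (s <= k)%N by rewrite -card_I -[leqRHS]card_ord max_card.
have P_gt0 : (0 < poly_norm P)%N.
  by rewrite expn_gt0; apply/orP; left; apply/card_gt0P; exists 0.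
apply/eqP; rewrite eqn_leq; apply/andP; split.
  apply/bigmax_leqP => A /(leq_card_independent hP hk); rewrite card_I.
  have -> : (poly_norm P ^ k = poly_norm P ^ (k - s) * poly_norm P ^ s)%N.
    by rewrite -expnD subnK.
  by rewrite leq_pmul2r // expn_gt0 P_gt0.
have card_C : #|digit_set P (~: exponents P k D)| = (poly_norm P ^ (k - s))%N.
  by rewrite card_digit_set // cardsCs setCK card_ord card_I.
rewrite -card_C; apply: (leq_bigmax_cond (F := fun A : {set _} => #|A|)).
exact: independent_digit_set.
Qed.
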